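(* For every $K>0$, the $\mathrm{Lip}_K$-pay-as-bid auction game with set of producers $\mathcal N$, production cost functions $C_i$ ($i\in\mathcal N$), and demand function $D$ admits at least one (pure strategy) Nash equilibrium $S^*$ having the form $$S_i^*(p)=K[p-x_i]_+\,,\qquad \forall p\in[0,p^*],$$ for every producer $i\in\mathcal N$, where $p^*=p^*(S^* )$ is the market-clearing price and $x_i\in[0,\hat p]$ (the activation price of producer $i$). Furthermore, for every Nash equilibrium $S^*$ of this game, with $p^*=p^*(S^* )$, and every $i\in\mathcal N$, $$S_i^*(p^* )>0\quad\Longleftrightarrow\quad C_i'(0)<p^*.$$
   Context: Notation: $\mathbb R_+=[0,\infty)$, $[t]_+=\max\{t,0\}$. Market: $\mathcal N=\{1,\dots,n\}$ is a non-empty finite set of producers. Each production cost function $C_i:\mathbb R_+\to\mathbb R_+$ is twice continuously differentiable, non-decreasing and convex. The demand function $D:\mathbb R_+\to\mathbb R$ is twice continuously differentiable, strictly decreasing, with $D(0)>0$, $\hat p:=\sup\{p\ge 0: D(p)>0\}<+\infty$, and $D$ concave on $[0,\hat p]$. $\mathrm{Lip}_K$ is the set of non-decreasing functions $F:[0,\hat p]\to\mathbb R_+$ with $F(0)=0$ and $|F(x)-F(y)|\le K|x-y|$ for all $x,y\in[0,\hat p]$. The $\mathrm{Lip}_K$-pay-as-bid auction game is the strategic game with player set $\mathcal N$, where each player $i$ chooses a supply function $S_i\in\mathrm{Lip}_K$. Given $S=(S_1,\dots,S_n)$, the market-clearing price $p^*(S)$ is the unique $p^*\in[0,\hat p]$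 with $D(p^* )=\sum_{i=1}^n S_i(p^* )$, and the utility of player $i$ is $$u_i(S)=p^*S_i(p^* )-\int_0^{p^*}S_i(p)\,dp-C_i(S_i(p^* )),\qquad p^*=p^*(S).$$ $S^*$ is a Nash equilibrium if for every $i$, $S_i^*$ maximizes $u_i(\cdot,S_{-i}^* )$ over $\mathrm{Lip}_K$. *)

(* Defs.v *)
From HB Require Import structures.
From mathcomp Require Import all_boot all_order all_algebra.
From mathcomp Require Import all_classical all_reals all_analysis.
From mathcomp Require Import lra.

Set Implicit Arguments.
Unset Strict Implicit.
Unset Printing Implicit Defensive.

Import Order.TTheory GRing.Theory Num.Theory.
Import numFieldNormedType.Exports.

Local Open Scope classical_set_scope.
Local Open Scope ring_scope.

(* A function on [0, +oo[ or on [0, phat] is represented by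
   a total function R -> R whose values outside its domain are irrelevant. *)

Definition pospart (R : realType) (t : R) : R := Num.max t 0.

(* Derivative of [f] relative to [A]: the usual derivative at interior points
   of [A], the one-sided derivative at an endpoint of an interval [A]. *)
Definition slope (R : realType) (f : R -> R) (x y : R) : R :=
  (f y - f x) / (y - x).

Definition derivable_within (R : realType) (A : set R) (f : R -> R) (x : R) :=
  cvg (slope f x y @[y --> within A x^']).

Definition derive_within (R : realType) (A : set R) (f : R -> R) (x : R) : R :=
  lim (slope f x y @[y --> within A x^']).

Definition twice_continuously_differentiable (R : realType) (A : set R)
    (f : R -> R) : Prop :=
  [/\ forall x, A x -> derivable_within A f x,
      forall x, A x -> derivable_within A (derive_within A f) x
    & {within A, continuous (derive_within A (derive_within A f))}].

Definition nonneg_reals {R : realType} : set R := `[0, +oo[.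

Definition cost_function (R : realType) (C : R -> R) : Prop :=
  [/\ forall q, 0 <= q -> 0 <= C q,
      twice_continuously_differentiable nonneg_reals C,
      forall q r, 0 <= q -> q <= r -> C q <= C r
    & @convex_function R R^o nonneg_reals C].

Definition max_price (R : realType) (D : R -> R) : R :=
  sup [set p | 0 <= p /\ 0 < D p].

(* [has_ubound] states that the supremum defining [max_price] is finite. *)
Definition demand_function (R : realType) (D : R -> R) : Prop :=
  [/\ twice_continuously_differentiable nonneg_reals D,
      forall p q, 0 <= p -> p < q -> D q < D p,
      0 < D 0,
      has_ubound [set p | 0 <= p /\ 0 < D p]
    & @convex_function R R^o `[0, max_price D] (fun p => - D p)].

Definition Lip (R : realType) (phat K : R) : set (R -> R) :=
  [set F | [/\ forall p, 0 <= p <= phat -> 0 <= F p,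
               forall p q, 0 <= p -> p <= q -> q <= phat -> F p <= F q,
               F 0 = 0
             & forall p q, 0 <= p <= phat -> 0 <= q <= phat ->
                 `|F p - F q| <= K * `|p - q|]].

Definition clears (R : realType) (D : R -> R) (n : nat) (S : 'I_n -> R -> R)
    (p : R) : Prop :=
  0 <= p <= max_price D /\ D p = \sum_(i < n) S i p.

(* The clearing price; the default value 0 of [xget] is never used on profiles
   of admissible supply functions (see [market_priceP] below). *)
Definition market_price (R : realType) (D : R -> R) (n : nat)
    (S : 'I_n -> R -> R) : R :=
  xget 0 [set p | clears D S p].

Definition utility (R : realType) (D : R -> R) (n : nat) (C : 'I_n -> R -> R)
    (S : 'I_n -> R -> R) (i : 'I_n) : R :=
  let p := market_price D S in
  p * S i p - (\int[lebesgue_measure]_(t in `[0, p]) S i t)%R - C i (S i p).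

(* Player [i] plays [T], the other players keep their strategy in [S]. *)
Definition deviation (R : realType) (n : nat) (S : 'I_n -> R -> R) (i : 'I_n)
    (T : R -> R) : 'I_n -> R -> R :=
  @dfwith _ (fun=> R -> R) S i T.

Definition nash_equilibrium (R : realType) (D : R -> R) (n : nat)
    (C : 'I_n -> R -> R) (K : R) (S : 'I_n -> R -> R) : Prop :=
  (forall i, Lip (max_price D) K (S i)) /\
  forall i (T : R -> R), Lip (max_price D) K T ->
    utility D C (deviation S i T) i <= utility D C S i.

Lemma derivable_within_cvg (R : realType) (A : set R) (f : R -> R) (x : R) :
  A x -> derivable_within A f x -> f y @[y --> within A (nbhs x)] --> f x.
Proof.
move=> Ax fx; apply/cvgrPdist_le => e e0.
set l := derive_within A f x.
have fl : slope f x y @[y --> within A x^'] --> l by [].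
have /cvgrPdist_le /(_ 1 ltr01) h := fl.
have d0 : 0 < e / (1 + `|l|) by rewrite divr_gt0// ltr_wpDr.
move: h; rewrite !near_withinE => h.
have hd : \forall y \near x, `|x - y| <= e / (1 + `|l|).
  by apply/nbhs_normP; exists (e / (1 + `|l|)) => //= y /= /ltW.
near=> y => Ay.
have [->|yx] := eqVneq y x; first by rewrite subrr normr0 ltW.
have yx0 : y - x != 0 by rewrite subr_eq0.
have hy : `|l - slope f x y| <= 1 by apply: (near h y _ yx Ay).
have hs : `|slope f x y| <= 1 + `|l|.
  have -> : slope f x y = l - (l - slope f x y) by rewrite subKr.
  by rewrite (le_trans (ler_normB _ _))// addrC lerD2r.
have -> : f x - f y = slope f x y * (x - y).
  by rewrite /slope -(opprB y x) mulrN divfK// opprB.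
rewrite normrM.
have hxy : `|x - y| <= e / (1 + `|l|) by near: y.
apply: le_trans (ler_pM _ _ hs hxy) _ => //.
by rewrite mulrC divfK// gt_eqF// ltr_wpDr.
Unshelve. all: by end_near. Qed.

Lemma demand_continuous (R : realType) (D : R -> R) (x : R) :
  demand_function D -> {within `[0, x], continuous D}.
Proof.
move=> [[dD _ _] _ _ _ _].
apply: (@continuous_subspaceW _ _ _ nonneg_reals).
  by move=> y; rewrite /nonneg_reals /= !in_itv /= andbT => /andP[].
apply/subspace_continuousP => y y0.
by apply: derivable_within_cvg => //; exact: dD.
Qed.

Lemma demand_max_price (R : realType) (D : R -> R) :
  demand_function D -> 0 <= max_price D /\ D (max_price D) <= 0.
Proof.
move=> hD; have [[dD _ _] decD D0 ubD _] := hD.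
set P := [set p | 0 <= p /\ 0 < D p].
have P0 : P 0 by [].
have m0 : 0 <= max_price D by apply: ub_le_sup.
split=> //; rewrite leNgt; apply/negP => Dm.
have A0 : nonneg_reals (max_price D) by rewrite /nonneg_reals/= in_itv/= m0.
have /cvgrPdist_lt /(_ _ Dm) := derivable_within_cvg A0 (dD _ A0).
rewrite near_withinE => /nbhs_normP [e /= e0 he].
have ee : 0 < e / 2 by rewrite divr_gt0.
have /he : `|max_price D - (max_price D + e / 2)| < e.
  by rewrite opprD addrA subrr sub0r normrN gtr0_norm//; lra.
have my : 0 <= max_price D + e / 2 by lra.
rewrite /nonneg_reals /= in_itv /= andbT => /(_ my).
rewrite ltr_norml => /andP[_ h].
have : max_price D + e / 2 <= max_price D.
  by apply: ub_le_sup => //; split=> //; lra.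
lra.
Qed.

Lemma Lip_continuous (R : realType) (phat K : R) (F : R -> R) :
  0 < K -> Lip phat K F -> {within `[0, phat], continuous F}.
Proof.
move=> K0 [_ _ _ lF]; apply/subspace_continuousP => x xA.
apply/cvgrPdist_le => e e0; rewrite near_withinE.
have d0 : 0 < e / K by rewrite divr_gt0.
apply/nbhs_normP; exists (e / K) => //= y /= xy yA.
move: xA yA; rewrite /= !in_itv /= => xA yA.
by apply: le_trans (lF _ _ xA yA) _; rewrite -ler_pdivlMl// mulrC ltW.
Qed.

Lemma clears_unique (R : realType) (D : R -> R) (n : nat) (K : R)
    (S : 'I_n -> R -> R) (p q : R) :
  demand_function D -> (forall i, Lip (max_price D) K (S i)) ->
  clears D S p -> clears D S q -> p = q.
Proof.
move=> [_ decD _ _ _] LS.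
wlog pq : p q / p <= q.
  by move=> H cp cq; case: (leP p q) => [|/ltW] h; [|symmetry]; apply: H.
move=> [/andP[p0 pm] Dp] [/andP[q0 qm] Dq].
apply/eqP; rewrite eq_le pq /= leNgt; apply/negP => plt.
have := decD _ _ p0 plt; rewrite Dp Dq ltNge => /negP; apply.
by apply: ler_sum => i _; have [_ mS _ _] := LS i; exact: mS.
Qed.

Lemma market_priceP (R : realType) (D : R -> R) (n : nat) (K : R)
    (S : 'I_n -> R -> R) :
  0 < K -> demand_function D -> (forall i, Lip (max_price D) K (S i)) ->
  clears D S (market_price D S).
Proof.
move=> K0 hD LS; have [m0 Dm] := demand_max_price hD.
have [_ _ D0 _ _] := hD.
suff ex : exists p, clears D S p by exact: (xgetPex 0 ex).
have cS : {within `[0, max_price D], continuous (fun p => \sum_(i < n) S i p)}.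
  apply/subspace_continuousP => x xA; apply: cvg_big => [|i _]; first exact: add_continuous.
  by move: (Lip_continuous K0 (LS i)) => /subspace_continuousP; apply.
have cg : {within `[0, max_price D],
    continuous (D \- (fun p => \sum_(i < n) S i p))}.
  exact: (within_continuousB (demand_continuous hD) cS).
have g0 : 0 <= (D \- (fun p => \sum_(i < n) S i p)) 0.
  rewrite /= big1 ?subr0 ?ltW// => i _.
  by have [] := LS i.
have gm : (D \- (fun p => \sum_(i < n) S i p)) (max_price D) <= 0.
  rewrite /= subr_le0 (le_trans Dm)//; apply: sumr_ge0 => i _.
  by have [h _ _ _] := LS i; apply: h; rewrite m0 lexx.
have [|c cm gc] := IVT (v := 0) m0 cg.
  by rewrite ge_min gm orbT le_max g0.
exists c; split; first by move: cm; rewrite in_itv.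
by apply/eqP; rewrite -subr_eq0; apply/eqP.
Qed.

(* Main.v *)
Require Import Defs.
From mathcomp Require Import all_boot all_order all_algebra.
From mathcomp Require Import all_classical all_reals all_analysis.
From mathcomp Require Import ring lra.
Import Order.TTheory GRing.Theory Num.Theory.
Import numFieldNormedType.Exports.
Set Implicit Arguments.
Unset Strict Implicit.
Unset Printing Implicit Defensive.
Local Open Scope classical_set_scope.
Local Open Scope ring_scope.

(** Among the supply functions of Lipschitz constant [K] through a point
    [(p, q)], the pay-as-bid utility is largest for the one with the smallest
    integral over [[0, p]], which is the ramp [K [t - x]_+] with
    [x = p - q / K]; its integral is [q ^ 2 / (2 K)] ([Lip_integral_ge],
    [Rintegral_ramp]).  A producer facing fixed opponents thus only chooses a
    point on the residual demand curve, with payoff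
    [p q - q ^ 2 / (2 K) - C q].

    Existence.  If every opponent plays a ramp that starts at or below the
    price [p], the concavity of the demand [D] and the convexity of ramps put
    the residual demand of each producer below the line through [(p, q)] of
    slope [- s], where [s = - D' p + K (n - 1)].  This is so even for an
    opponent who sells nothing, as long as the ramp starts exactly at [p]: the
    slope [- K] is then a supergradient at the kink of the residual demand.
    The same [s] therefore serves all producers, whoever is active.  On that
    line the payoff is concave in the quantity, so its first-order condition
    [q / s + q / K + C' q = max (p, C' 0)] is sufficient
    ([foc_root_optimal]).  For a given [p] this equation has a unique solution
    [q_i p], continuous in [p], and the intermediate value theorem gives a
    price with [D p = \sum_i q_i p] ([equilibrium_price_exists]).  The ramps
    that start at [p - q_i p / K] are a Nash equilibrium
    ([ramp_equilibrium_exists]).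

    Activity.  At any equilibrium of price [p], if [C_i' 0 >= p] while
    producer [i] sells a positive quantity, then the bid of [i] loses strictly
    against the zero bid; if [C_i' 0 < p] while [i] sells nothing, then a ramp
    that starts slightly below [p] earns strictly more than selling nothing
    ([active_marginal_lt], [marginal_lt_active]). *)

(** * Tangent lines of convex functions *)

(** The derivative [l] is taken within a set [A] that may be larger than the
    interval [B] on which [f] is convex: the demand is differentiable on
    [[0, +oo[] but concave on [[0, max_price D]] only. *)
Lemma convex_tangent (R : realType) (A B : set R) (f : R -> R) (l x y : R) :
  B `<=` A -> is_interval B -> @convex_function R R^o B f ->
  slope f x z @[z --> within A x^'] --> l -> B x -> B y ->
  f x + l * (y - x) <= f y.
Proof.
move=> BA iB cf fx Bx By; have [<-|xy] := eqVneq x y.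
  by rewrite subrr mulr0 addr0.
have yx0 : y - x != 0 by rewrite subr_eq0 eq_sym.
have path t : 0 < t -> t < 1 -> B (x + t * (y - x)).
  move=> t0 t1; case: (leP x y) => h.
    by apply: (iB x y) => //; apply/andP; split; nra.
  by apply: (iB y x) => //; apply/andP; split; nra.
pose g t := x + t * (y - x).
(* Let [z] tend to [x] along the segment towards [y]: by convexity the slope at
   [z], times [y - x], is at most [f y - f x]. *)
have cg : g t @[t --> 0^'+] --> within A x^'.
  move=> P /= [e /= e0 he].
  suff : \forall t \near 0^'+, P (g t) by [].
  near=> t.
  have t0 : 0 < t by near: t; exact: nbhs_right_gt.
  have t1 : t < 1 by near: t; exact: nbhs_right_lt.
  rewrite /=; apply: he => /=; last first.
  - exact/BA/path.
  - by rewrite /g -subr_eq0 addrC addKr mulf_neq0// gt_eqF.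
  - rewrite /g opprD addrA subrr sub0r normrN normrM (gtr0_norm t0).
    rewrite -ltr_pdivlMr ?normr_gt0//; near: t; apply: nbhs_right_lt.
    by rewrite divr_gt0// normr_gt0.
have lim_slope : slope f x (g t) * (y - x) @[t --> 0^'+] --> l * (y - x).
  by apply: cvgMl; exact: (cvg_comp _ _ cg fx).
suff : l * (y - x) <= f y - f x by rewrite lerBrDl.
rewrite -(cvg_lim _ lim_slope)//; apply: limr_le.
  by apply: cvgP lim_slope.
near=> t.
have t0 : 0 < t by near: t; exact: nbhs_right_gt.
have t1 : t < 1 by near: t; exact: nbhs_right_lt.
have := cf (Itv01 (ltW t0) (ltW t1)) y x (mem_set By) (mem_set Bx).
rewrite !convRE/= => h.
have : f (g t) <= t * f y + (1 - t) * f x.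
  apply: le_trans h; rewrite le_eqVlt; apply/orP; left; apply/eqP; congr f.
  by transitivity (t * y + (1 - t) * x); [rewrite /g; ring|].
move=> {}h; rewrite /slope /g.
have -> : x + t * (y - x) - x = t * (y - x) by ring.
have -> : (f (x + t * (y - x)) - f x) / (t * (y - x)) * (y - x)
   = (f (g t) - f x) / t.
  by rewrite /g; field; rewrite yx0 gt_eqF.
by rewrite ler_pdivrMr//; lra.
Unshelve. all: by end_near. Qed.

(** * Ramps and the cheapest supply function through a point *)

(** The supply function of slope [K] with activation price [x]. *)
Definition ramp {R : realType} (K x : R) : R -> R :=
  fun p => K * pospart (p - x).

Section ramp.
Context {R : realType}.
Implicit Types K x p q phat : R.

Lemma ramp0 K x p : p <= x -> ramp K x p = 0.
Proof. by move=> px; rewrite /ramp /pospart max_r ?mulr0// subr_le0. Qed.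

Lemma rampE K x p : x <= p -> ramp K x p = K * (p - x).
Proof. by move=> px; rewrite /ramp /pospart max_l// subr_ge0. Qed.

Lemma ramp_Lip phat K x : 0 <= K -> 0 <= x -> Lip phat K (ramp K x).
Proof.
move=> K0 x0; split.
- by move=> p _; rewrite mulr_ge0// /pospart le_max lexx orbT.
- move=> p q _ pq _; rewrite ler_wpM2l// /pospart ge_max !le_max lexx orbT.
  by rewrite lerD2r pq.
- by rewrite ramp0.
- move=> p q _ _; rewrite -mulrBr normrM (ger0_norm K0) ler_wpM2l//.
  have := ler_norm (p - q); have := ler_norm (q - p); rewrite (distrC q p).
  rewrite /pospart ler_norml => ? ?.
  by case: (lerP (p - x) 0) => ?; case: (lerP (q - x) 0) => ?;
    apply/andP; split; lra.
Qed.

Lemma ramp_continuous K x (A : set R) : {within A, continuous (ramp K x)}.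
Proof.
apply: continuous_subspaceT => p.
apply: cvgMr; apply: (@continuous_max R R (fun p => p - x) (cst 0) p).
  by apply: cvgB; [exact: cvg_id|exact: cvg_cst].
exact: cvg_cst.
Qed.

Lemma Rintegral_ramp K x p : 0 <= x <= p ->
  (\int[lebesgue_measure]_(t in `[0, p]) ramp K x t)%R = K * (p - x) ^+ 2 / 2.
Proof.
move=> /andP[x0 xp].
have ci a : lebesgue_measure.-integrable `[a, p] (EFin \o ramp K x).
  apply: continuous_compact_integrable; first exact: segment_compact.
  exact: ramp_continuous.
have i0 : (\int[lebesgue_measure]_(t in `[0, x]) ramp K x t)%R = 0.
  transitivity (\int[lebesgue_measure]_(t in `[0%R, x]) (cst 0 t : R))%R.
    apply: eq_Rintegral => t; rewrite inE /= in_itv/= => /andP[_ tx].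
    exact: ramp0.
  by rewrite Rintegral_cst ?mul0r.
have := Rintegral_itvB (x := x) (ci 0).
rewrite !bnd_simp => /(_ x0 xp); rewrite i0 subr0 => ->.
rewrite Rintegral_itv_obnd_cbnd; last first.
  apply: (integrableS _ _ _ (ci x)) => //.
  by apply: subset_itvr; rewrite bnd_simp.
move: xp; rewrite le_eqVlt => /predU1P[->|xp].
  by rewrite set_itv1 Rintegral_set1 subrr expr0n/= mulr0 mul0r.
pose F t := K / 2 * (t - x) ^+ 2.
have dF (t : R) : is_derive t 1 F (K * (t - x)).
  apply: is_derive_eq.
  by rewrite /GRing.scale/=; field.
have cF (t : R) : {for t, continuous F}.
  by apply: differentiable_continuous; apply/derivable1_diffP.
rewrite /Rintegral (continuous_FTC2 (F := F) xp).
- by rewrite /= /F subrr expr0n/= mulr0 subr0; ring.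
- exact: ramp_continuous.
- split; first by move=> t _; have [] := dF t.
  + exact/cvg_at_right_filter/cF.
  + exact/cvg_at_left_filter/cF.
- move=> t; rewrite in_itv/= => /andP[/ltW xt _].
  by rewrite derive1E derive_val rampE.
Qed.
End ramp.

Section lip.
Context {R : realType}.
Implicit Types K p phat : R.

(** The left-hand side is the integral of the ramp through [(p, F p)], which
    lies below [F] on [[0, p]] because [F] is nonnegative and Lipschitz. *)
Lemma Lip_integral_ge phat K F p : 0 < K -> Lip phat K F -> 0 <= p <= phat ->
  F p ^+ 2 / (2 * K) <= (\int[lebesgue_measure]_(t in `[0, p]) F t)%R.
Proof.
move=> K0 LF /andP[p0 pm]; have [F0 mF F00 lF] := LF.
have Fp0 : 0 <= F p by apply: F0; rewrite p0.
have FpK : F p / K <= p.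
  rewrite ler_pdivrMr// mulrC.
  have := lF p 0; rewrite p0 pm lexx (le_trans p0 pm) => /(_ isT isT).
  by rewrite F00 !subr0 !ger0_norm.
have FK0 : 0 <= F p / K by rewrite divr_ge0// ltW.
rewrite (_ : _ / _ = K * (p - (p - F p / K)) ^+ 2 / 2); last first.
  by field; rewrite gt_eqF.
rewrite -Rintegral_ramp; last by apply/andP; split; lra.
apply: le_Rintegral => //.
- apply: continuous_compact_integrable; first exact: segment_compact.
  exact: ramp_continuous.
- apply: continuous_compact_integrable; first exact: segment_compact.
  apply: continuous_subspaceW (Lip_continuous K0 LF).
  by move=> t /=; rewrite !in_itv/= => /andP[-> /le_trans->].
- move=> t; rewrite /= in_itv/= => /andP[t0 tp].
  have tm : 0 <= t <= phat by rewrite t0 (le_trans tp).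
  have [tx|xt] := leP t (p - F p / K); first by rewrite ramp0// F0.
  rewrite rampE ?(ltW xt)//.
  have := lF p t; rewrite p0 pm tm => /(_ isT isT).
  rewrite (@ger0_norm _ (p - t)) ?subr_ge0//.
  move=> /(le_trans (ler_norm _)) h.
  have -> : K * (t - (p - F p / K)) = F p - K * (p - t).
    by field; rewrite gt_eqF.
  lra.
Qed.

End lip.

(** * Marginal costs and demand slopes *)

(** Derivative relative to [[0, +oo[], one-sided at 0. *)
Notation derive_nonneg := (derive_within nonneg_reals).

Section cost.
Context {R : realType} {C : R -> R} (hC : cost_function C).
Implicit Types q r : R.

Lemma nonneg_realsE q : nonneg_reals q = (0 <= q) :> Prop.
Proof. by rewrite /nonneg_reals /= in_itv/= andbT. Qed.

Lemma cost_tangent q r : 0 <= q -> 0 <= r ->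
  C q + derive_nonneg C q * (r - q) <= C r.
Proof.
move=> q0 r0; have [_ [dC _ _] _ cC] := hC.
apply: (convex_tangent (@subset_refl _ nonneg_reals) _ cC);
  rewrite ?nonneg_realsE//.
  exact: interval_is_interval.
by apply: dC; rewrite nonneg_realsE.
Qed.

Lemma marginal_le q r : 0 <= q -> q <= r ->
  derive_nonneg C q <= derive_nonneg C r.
Proof.
move=> q0; rewrite le_eqVlt => /predU1P[->//|qr].
have r0 : 0 <= r by apply: le_trans (ltW qr).
have := cost_tangent q0 r0; have := cost_tangent r0 q0; nra.
Qed.

Lemma marginal_ge0 q : 0 < q -> 0 <= derive_nonneg C q.
Proof.
move=> q0; have := cost_tangent (ltW q0) (lexx 0).
have [_ _ /(_ 0 q (lexx 0) (ltW q0)) C0q _] := hC.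
move=> h; rewrite -(pmulr_lge0 _ q0); lra.
Qed.

Lemma marginal_continuous : {within nonneg_reals, continuous (derive_nonneg C)}.
Proof.
have [_ [_ dC _] _ _] := hC.
apply/subspace_continuousP => q q0.
exact: derivable_within_cvg (dC _ q0).
Qed.

End cost.

Section demand.
Context {R : realType} {D : R -> R} (hD : demand_function D).
Implicit Types p q : R.

Lemma demand_tangent p q : 0 <= p <= max_price D -> 0 <= q <= max_price D ->
  D q <= D p + derive_nonneg D p * (q - p).
Proof.
move=> pm qm; have [[dD _ _] _ _ _ cD] := hD.
rewrite -lerN2 opprD -mulNr.
apply: (@convex_tangent _ nonneg_reals _ _ _ _ _ _ _ cD).
- by move=> t /=; rewrite nonneg_realsE in_itv/= => /andP[].
- exact: interval_is_interval.
- rewrite (_ : slope _ p = - slope D p); last first.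
    by apply/funext => z; rewrite fctE /slope/= opprK addrC -mulNr opprB.
  by apply: cvgN; apply: dD; rewrite nonneg_realsE; case/andP: pm.
- by rewrite /= in_itv.
- by rewrite /= in_itv.
Qed.

(** The price 0 is excluded: the slope of the demand may vanish there. *)
Lemma demand_slope_lt0 p : 0 < p <= max_price D -> derive_nonneg D p < 0.
Proof.
move=> /andP[p0 pm]; have [_ /(_ 0 p (lexx 0) p0) Dp _ _ _] := hD.
have := @demand_tangent p 0; rewrite (ltW p0) pm lexx (le_trans (ltW p0) pm).
by move=> /(_ isT isT) h; rewrite -(pmulr_llt0 _ p0); lra.
Qed.

Lemma demand_slope_continuous :
  {within nonneg_reals, continuous (derive_nonneg D)}.
Proof.
have [[_ dD _] _ _ _ _] := hD.
apply/subspace_continuousP => q q0.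
exact: derivable_within_cvg (dD _ q0).
Qed.

End demand.

(** * The quantity offered at a given price *)

(** First-order condition of a producer of cost [C] who chooses a quantity [q]
    at price [p] against a residual demand of slope [- s].  For [s != 0],
    [foc C K s p q = 0] is [q / s + q / K + C' q = max (p, C' 0)] multiplied by
    [s], a form that still makes sense, and forces [q = 0], when [s = 0]; this
    can happen at price 0 for a single producer.  The maximum makes 0 the
    solution when [p] is below the marginal cost at 0. *)
Definition foc {R : realType} (C : R -> R) (K s p q : R) : R :=
  q * (1 + s / K) + s * (derive_nonneg C q - Num.max p (derive_nonneg C 0)).

Section best_quantity.
Context {R : realType} {C : R -> R} (hC : cost_function C).
Context {K : R} (K_gt0 : 0 < K).
Implicit Types s p q r : R.

Lemma foc_solvable s p : 0 <= s -> exists2 q, 0 <= q & foc C K s p q = 0.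
Proof.
move=> s0; set c := derive_nonneg C 0.
have sK : 0 <= s / K by rewrite divr_ge0// ltW.
(* [foc] is nonnegative at [Q] because [C' Q >= C' 0 = c]. *)
pose Q := s * (Num.max p c - c).
have cm : c <= Num.max p c by rewrite le_max lexx orbT.
have Q0 : 0 <= Q by rewrite mulr_ge0// subr_ge0.
have cg : {within `[0, Q], continuous (foc C K s p)}.
  apply/subspace_continuousP => q qQ.
  apply: cvgD.
    apply: cvgMl; apply: cvg_within_filter; exact: cvg_id.
  apply: cvgMr; apply: cvgB; last exact: cvg_cst.
  suff : {within `[0, Q], continuous (derive_nonneg C)}.
    by move=> /subspace_continuousP; exact.
  apply: continuous_subspaceW (marginal_continuous hC).
  by move=> t /=; rewrite nonneg_realsE in_itv/= => /andP[].
have g0 : foc C K s p 0 <= 0.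
  by rewrite /foc mul0r add0r mulr_ge0_le0// subr_le0.
have gQ : 0 <= foc C K s p Q.
  have := marginal_le hC (lexx 0) Q0; rewrite -/c => cQ.
  rewrite /foc -/c mulrDr mulr1.
  have : s * (c - Num.max p c) <= s * (derive_nonneg C Q - Num.max p c).
    by rewrite ler_wpM2l// lerD2r.
  have : 0 <= Q * (s / K) by rewrite mulr_ge0.
  have : Q = s * (Num.max p c - c) by [].
  lra.
have [|q] := IVT (v := 0) Q0 cg.
  by rewrite ge_min g0 le_max gQ orbT.
by rewrite in_itv/= => /andP[q0 _] gq; exists q.
Qed.

(** Hence the nonnegative root of [foc C K s p] is unique and depends
    continuously on [s] and [p] (see [foc_root_continuous]). *)
Lemma foc_expand s p q r : 0 <= s -> 0 <= q -> 0 <= r ->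
  `|q - r| <= `|foc C K s p q - foc C K s p r|.
Proof.
move=> s0; wlog rq : q r / r <= q.
  move=> H q0 r0; have [|/ltW] := leP r q => h; first exact: H.
  by rewrite distrC (distrC (foc _ _ _ _ _)); exact: H.
move=> q0 r0; have mrq := marginal_le hC r0 rq.
have sK : 0 <= s / K by rewrite divr_ge0// ltW.
rewrite ger0_norm ?subr_ge0// (le_trans _ (ler_norm _))//.
have -> : foc C K s p q - foc C K s p r =
  (q - r) + (q - r) * (s / K) + s * (derive_nonneg C q - derive_nonneg C r).
  by rewrite /foc; ring.
have : 0 <= (q - r) * (s / K) by rewrite mulr_ge0// subr_ge0.
have : 0 <= s * (derive_nonneg C q - derive_nonneg C r).
  by rewrite mulr_ge0// subr_ge0.
lra.
Qed.

Lemma foc_root_continuous (A : set R) (s q : R -> R) :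
  {within A, continuous s} -> (forall p, A p -> 0 <= s p) ->
  (forall p, A p -> 0 <= q p) -> (forall p, A p -> foc C K (s p) p (q p) = 0) ->
  {within A, continuous q}.
Proof.
move=> /subspace_continuousP cs s0 q0 fq; apply/subspace_continuousP => p Ap.
have cf : foc C K (s x) x (q p) @[x --> within A (nbhs p)] --> (0 : R).
  rewrite -(fq p Ap); apply: cvgD.
    apply: cvgMr; apply: cvgD; first exact: cvg_cst.
    by apply: cvgMl; exact: cs.
  apply: cvgM; first exact: cs.
  apply: cvgB; first exact: cvg_cst.
  apply: cvg_within_filter.
  apply: (@continuous_max R R idfun (cst (derive_nonneg C 0)) p).
    exact: cvg_id.
  exact: cvg_cst.
apply/cvgrPdist_le => e e0; move/cvgrPdist_le : cf => /(_ e e0).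
rewrite !near_withinE; apply: filterS => x + Ax => /(_ Ax).
rewrite sub0r normrN => h; rewrite distrC (le_trans _ h)//.
apply: le_trans (foc_expand x (s0 _ Ax) (q0 _ Ax) (q0 _ Ap)) _.
by rewrite fq// sub0r normrN.
Qed.

Lemma foc_rootE s p q : 0 < s -> 0 <= q -> foc C K s p q = 0 ->
  derive_nonneg C 0 < p -> p = derive_nonneg C q + q / s + q / K.
Proof.
move=> s0 q0 + /ltW cp; rewrite /foc max_l// => h.
have s0' : s != 0 by rewrite gt_eqF.
have K0' : K != 0 by rewrite gt_eqF.
apply/(mulfI s0')/eqP; rewrite -subr_eq0 -oppr_eq0; apply/eqP; rewrite -[RHS]h.
by field; rewrite s0' K0'.
Qed.

Lemma foc_root_eq0 s p q : 0 < s -> 0 <= q -> foc C K s p q = 0 ->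
  p <= derive_nonneg C 0 -> q = 0.
Proof.
move=> s0 q0 + pc; rewrite /foc max_r// mulrDr mulr1 => h.
have : 0 <= q * (s / K) by rewrite mulr_ge0// divr_ge0// ltW.
have : 0 <= s * (derive_nonneg C q - derive_nonneg C 0).
  by apply: mulr_ge0; [exact: ltW|rewrite subr_ge0 marginal_le].
lra.
Qed.

(** The activation price [p - q / K] of the ramp through [(p, q)] is
    nonnegative. *)
Lemma foc_root_le s p q : 0 < s -> 0 <= p -> 0 <= q -> foc C K s p q = 0 ->
  q / K <= p.
Proof.
move=> s0 p0 q0 fq; have [pc|cp] := leP p (derive_nonneg C 0).
  by rewrite (foc_root_eq0 s0 q0 fq)// mul0r.
have [->|qn0] := eqVneq q 0; first by rewrite mul0r.
have q0' : 0 < q by rewrite lt_neqAle eq_sym qn0.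
rewrite [leRHS](foc_rootE s0 q0 fq)// lerDr addr_ge0 ?marginal_ge0//.
by rewrite divr_ge0// ltW.
Qed.

(** Global optimality of the root: [(p, q)] beats every point [(p', r)] on or
    below the line of slope [- s] through [(p, q)]. *)
Lemma foc_root_optimal s p q r p' : 0 < s -> 0 <= q -> foc C K s p q = 0 ->
  0 <= r -> s * (p' - p) <= q - r ->
  p' * r - r ^+ 2 / (2 * K) - C r <= p * q - q ^+ 2 / (2 * K) - C q.
Proof.
move=> s0 q0 fq r0 hp.
have s0' : s != 0 by rewrite gt_eqF.
have K0' : K != 0 by rewrite gt_eqF.
(* The variational inequality of a concave maximisation over [r >= 0]. *)
have vi : (p - derive_nonneg C q - q / s - q / K) * (r - q) <= 0.
  have [pc|cp] := leP p (derive_nonneg C 0).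
    rewrite (foc_root_eq0 s0 q0 fq)// !mul0r !subr0.
    by rewrite mulr_le0_ge0// subr_le0.
  by rewrite {1}(foc_rootE s0 q0 fq)// (_ : _ - _ = 0) ?mul0r//; ring.
have tC := cost_tangent hC q0 r0.
have pr : p' * r <= (p + (q - r) / s) * r.
  by rewrite ler_wpM2r// -lerBlDl ler_pdivlMr// mulrC.
have sq : 0 <= (r - q) ^+ 2 * (s^-1 + (2 * K)^-1).
  by rewrite mulr_ge0 ?sqr_ge0// addr_ge0// invr_ge0 ?mulr_ge0// ltW.
have : (p + (q - r) / s) * r - r ^+ 2 / (2 * K) -
    (C q + derive_nonneg C q * (r - q))
  = p * q - q ^+ 2 / (2 * K) - C q +
    (p - derive_nonneg C q - q / s - q / K) * (r - q) -
    (r - q) ^+ 2 * (s^-1 + (2 * K)^-1).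
  by field; rewrite s0' K0'.
lra.
Qed.

End best_quantity.

(** * The auction game *)

Section game.
Context {R : realType} {n : nat} {C : 'I_n -> R -> R} {D : R -> R} {K : R}.
Context (hC : forall i, cost_function (C i)) (hD : demand_function D).
Context (K_gt0 : 0 < K).
Implicit Types (S : 'I_n -> R -> R) (T : R -> R).

Lemma sum_deviation S i T p :
  \sum_(j < n) deviation S i T j p = T p + \sum_(j < n | j != i) S j p.
Proof.
rewrite (bigD1 i)//= /deviation dfwithin; congr (_ + _).
by apply: eq_bigr => j ji; rewrite dfwithout// eq_sym.
Qed.

Lemma deviation_Lip S i T : (forall j, Lip (max_price D) K (S j)) ->
  Lip (max_price D) K T -> forall j, Lip (max_price D) K (deviation S i T j).
Proof.
move=> LS LT j; have [->|ji] := eqVneq j i.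
  by rewrite /deviation dfwithin.
by rewrite /deviation dfwithout// eq_sym.
Qed.

Lemma market_price_gt0 S : (forall j, Lip (max_price D) K (S j)) ->
  0 < market_price D S.
Proof.
move=> LS; have [/andP[p0 _]] := market_priceP K_gt0 hD LS.
move: p0; rewrite le_eqVlt => /predU1P[<-|//].
have [_ _ D0 _ _] := hD; rewrite big1 ?(gt_eqF D0)// => [D00|i _].
  by rewrite D00 ltxx in D0.
by have [] := LS i.
Qed.

Lemma utility_deviation S i T : utility D C (deviation S i T) i =
  market_price D (deviation S i T) * T (market_price D (deviation S i T))
  - (\int[lebesgue_measure]_(t in `[0, market_price D (deviation S i T)]) T t)%R
  - C i (T (market_price D (deviation S i T))).
Proof. by rewrite /utility /deviation dfwithin. Qed.

(** The slope [- D' p + K (n - 1)] counts every opponent as if active at [p]. *)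
Lemma equilibrium_price_exists :
  exists p (q : 'I_n -> R),
    [/\ 0 < p <= max_price D, D p = \sum_i q i, forall i, 0 <= q i &
     forall i, foc (C i) K (- derive_nonneg D p + K * n.-1%:R) p (q i) = 0].
Proof.
have [m0 Dm] := demand_max_price hD; have [_ _ D0 _ _] := hD.
(* The absolute value avoids a sign discussion at price 0; for [p > 0] it is
   [- D' p]. *)
pose s p := `|derive_nonneg D p| + K * n.-1%:R.
have s0 p : 0 <= s p by rewrite addr_ge0// mulr_ge0// ltW.
have /choice[q hq] (ip : 'I_n * R) :
    exists q, 0 <= q /\ foc (C ip.1) K (s ip.2) ip.2 q = 0.
  by have [q ? ?] := foc_solvable (hC ip.1) K_gt0 ip.2 (s0 ip.2); exists q.
have cs : {within `[0, max_price D], continuous s}.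
  apply: (@continuous_subspaceW _ _ _ nonneg_reals).
    by move=> t /=; rewrite nonneg_realsE in_itv/= => /andP[].
  have /subspace_continuousP cD := demand_slope_continuous hD.
  apply/subspace_continuousP => t t0; apply: cvgD; last exact: cvg_cst.
  by apply: cvg_norm; exact: cD.
have cq i : {within `[0, max_price D], continuous (fun p => q (i, p))}.
  apply: (foc_root_continuous (hC i) K_gt0 cs) => // p _.
    by have [] := hq (i, p).
  by have [] := hq (i, p).
have cg : {within `[0, max_price D],
    continuous (D \- (fun p => \sum_i q (i, p)))}.
  apply: (within_continuousB (demand_continuous hD)).
  apply/subspace_continuousP => x xA; apply: cvg_big => [|i _].
    exact: add_continuous.
  by move: (cq i) => /subspace_continuousP; apply.
have q00 i : q (i, 0) = 0.
  have [/= q0 f0] := hq (i, 0); apply/eqP; rewrite eq_le q0 andbT.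
  have /predU1P[s00|sp] : (0 == s 0) || (0 < s 0) by rewrite -le_eqVlt.
    by move: f0; rewrite /foc -s00 !mul0r addr0 addr0 mulr1 => ->.
  have := foc_root_le (hC i) K_gt0 sp (lexx 0) q0 f0.
  by rewrite pmulr_lle0// invr_gt0.
have [|p] := IVT (v := 0) m0 cg.
  rewrite /= [X in D 0 - X]big1 ?subr0; last by move=> i _; exact: q00.
  rewrite ge_min le_max (ltW D0)/= andbT; apply/orP; right.
  rewrite subr_le0 (le_trans Dm)//; apply: sumr_ge0 => i _.
  by have [] := hq (i, max_price D).
rewrite in_itv/= => /andP[p0 pm] /eqP; rewrite subr_eq0 => /eqP Dp.
have {}p0 : 0 < p.
  rewrite lt_neqAle p0 andbT; apply/eqP => p00; move: Dp; rewrite -p00 big1//.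
  by move=> D00; rewrite D00 ltxx in D0.
exists p, (fun i => q (i, p)); split => //.
- by rewrite p0.
- by move=> i; have [] := hq (i, p).
- move=> i; have [_] := hq (i, p); rewrite /s/= ltr0_norm//.
  by apply: demand_slope_lt0; rewrite ?p0.
Qed.

(** Producers who sell nothing at the equilibrium price [p] are given a ramp
    that starts exactly at [p], not higher: this steepens the residual demand
    of the others beyond [p]. *)
Lemma ramp_equilibrium_exists :
  exists S, nash_equilibrium D C K S /\
     exists x : 'I_n -> R, forall i,
       0 <= x i <= max_price D /\ S i = ramp K (x i).
Proof.
have [p [q [/andP[p0 pm] Dp q0 fq]]] := equilibrium_price_exists.
set s := - derive_nonneg D p + _ in fq.
have D'p : derive_nonneg D p < 0 by apply: demand_slope_lt0 => //; rewrite p0.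
have s0 : 0 < s by rewrite /s ltr_pwDl ?oppr_gt0// mulr_ge0// ltW.
have qKp i : q i / K <= p.
  by apply: (foc_root_le (hC i) K_gt0 s0 (ltW p0)).
have qK0 i : 0 <= q i / K by rewrite divr_ge0// ltW.
pose x i := p - q i / K.
pose S i := ramp K (x i).
have x0 i : 0 <= x i by rewrite subr_ge0.
have xp i : x i <= p by rewrite gerBl.
have LS i : Lip (max_price D) K (S i) by apply: ramp_Lip => //; exact: ltW.
have Sp i : S i p = q i.
  by rewrite /S rampE// /x; field; rewrite gt_eqF.
have pmm : 0 <= p <= max_price D by rewrite ltW.
have mS : market_price D S = p.
  apply: (clears_unique hD LS); first exact: market_priceP K_gt0 hD LS.
  by split=> //; rewrite Dp; apply: eq_bigr => i _; rewrite Sp.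
exists S; split; last first.
  by exists x => i; split => //; rewrite x0 (le_trans (xp i)).
split=> // i T LT.
have LS' := deviation_Lip i LS LT.
have [p'm] := market_priceP K_gt0 hD LS'.
rewrite utility_deviation /utility mS sum_deviation Sp /=.
set p' := market_price _ _ in p'm *; move=> Dp'.
have T0 : 0 <= T p' by have [h _ _ _] := LT; exact: h.
have IT := Lip_integral_ge K_gt0 LT p'm.
rewrite Rintegral_ramp ?x0 ?xp//.
have -> : K * (p - x i) ^+ 2 / 2 = q i ^+ 2 / (2 * K).
  by rewrite /x; field; rewrite gt_eqF.
(* The residual demand of [i] lies below its tangent of slope [- s] at [p]:
   each opposing ramp lies above its line of slope [K] through [(p, q j)]. *)
have spp : s * (p' - p) <= q i - T p'.
  have : \sum_(j < n | j != i) (q j + K * (p' - p)) <=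
         \sum_(j < n | j != i) S j p'.
    apply: ler_sum => j _; rewrite (_ : _ + _ = K * (p' - x j)); last first.
      by rewrite /x; field; rewrite gt_eqF.
    by apply: ler_wpM2l; [exact: ltW|rewrite le_max lexx].
  rewrite big_split/= sumr_const cardC1 card_ord => hS.
  have := demand_tangent hD pmm p'm.
  have Dpi : D p = q i + \sum_(j < n | j != i) q j by rewrite Dp (bigD1 i).
  rewrite Dp' Dpi /s => hDp.
  have : K * (p' - p) *+ n.-1 = K * n.-1%:R * (p' - p).
    by rewrite -mulr_natr; ring.
  lra.
have := foc_root_optimal (hC i) K_gt0 s0 (q0 i) (fq i) T0 spp.
lra.
Qed.

Lemma active_marginal_lt S i : nash_equilibrium D C K S ->
  0 < S i (market_price D S) -> derive_nonneg (C i) 0 < market_price D S.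
Proof.
move=> [LS bS] Sp; rewrite ltNge; apply/negP => pc.
(* Deviate to the zero bid. *)
have L0 : Lip (max_price D) K (fun=> 0).
  by split=> // p q _ _; rewrite subrr normr0 mulr_ge0// ltW.
have := bS i _ L0.
rewrite utility_deviation Rintegral_cst// mul0r mulr0 subr0 sub0r.
rewrite /utility /=.
have [pm _] := market_priceP K_gt0 hD LS.
set p := market_price D S in Sp pc pm *; set q := S i p in Sp *.
have := Lip_integral_ge K_gt0 (LS i) pm; rewrite -/q.
have : 0 < q ^+ 2 / (2 * K) by rewrite divr_gt0 ?exprn_gt0// mulr_gt0.
have := cost_tangent (hC i) (lexx 0) (ltW Sp).
have : p * q <= derive_nonneg (C i) 0 * q by rewrite ler_pM2r.
rewrite subr0; lra.
Qed.

Lemma marginal_lt_active S i : nash_equilibrium D C K S ->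
  derive_nonneg (C i) 0 < market_price D S -> 0 < S i (market_price D S).
Proof.
move=> [LS bS] cp; have p0 := market_price_gt0 LS.
have [pm Dp] := market_priceP K_gt0 hD LS.
have := bS i; rewrite {2}/utility /=.
set p := market_price D S in cp p0 pm Dp *.
set c := derive_nonneg (C i) 0 in cp *.
have [S0 _ _ _] := LS i.
rewrite lt_neqAle S0// andbT => /= best; apply/eqP => Sp0.
have [_ dec _ _ _] := hD.
have /subspace_continuousP /(_ 0) := marginal_continuous (hC i).
rewrite nonneg_realsE => /(_ (lexx 0)) /cvgrPdist_lt.
pose m := (p - c) / 2; have m0 : 0 < m by rewrite divr_gt0// subr_gt0.
move=> /(_ _ m0); rewrite near_withinE => /nbhs_normP[d /= d0 hd].
(* Deviate to the ramp that starts at [p - e]: the new price lies in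
   [(p - e, p]] and the quantity sold is at most [K e], so that for [e] this
   small the marginal cost stays below the average price paid. *)
pose e := Num.min (Num.min p (m / 2)) (d / (2 * K)).
have e0 : 0 < e by rewrite !lt_min p0 (divr_gt0 m0)// divr_gt0// mulr_gt0.
have ep : e <= p by rewrite !ge_min lexx.
have em : e <= m / 2 by rewrite !ge_min lexx orbT.
have ed : K * e < d.
  have : e <= d / (2 * K) by rewrite !ge_min lexx orbT.
  rewrite ler_pdivlMr ?mulr_gt0//; lra.
pose x := p - e; have x0 : 0 <= x by rewrite subr_ge0.
have xp : x < p by rewrite gtrBl.
have LT : Lip (max_price D) K (ramp K x) by apply: ramp_Lip => //; exact: ltW.
have LS' := deviation_Lip i LS LT.
have := best _ LT; rewrite utility_deviation.
have [p'm] := market_priceP K_gt0 hD LS'; rewrite sum_deviation.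
set p' := market_price _ _ in p'm *; move=> Dp'.
have Dpi : D p = \sum_(j < n | j != i) S j p.
  by rewrite Dp (bigD1 i)//= -Sp0 add0r.
have mono a b : 0 <= a -> a <= b -> b <= max_price D ->
    \sum_(j < n | j != i) S j a <= \sum_(j < n | j != i) S j b.
  by move=> a0 ab bm; apply: ler_sum => j _; have [_ h _ _] := LS j; exact: h.
have /andP[p'0 p'm'] := p'm; have /andP[_ pm'] := pm.
have xp' : x < p'.
  rewrite ltNge; apply/negP => p'x; have p'p := le_lt_trans p'x xp.
  have := mono _ _ p'0 (ltW p'p) pm'; have := dec _ _ p'0 p'p.
  by rewrite Dp' ramp0// add0r Dpi; lra.
have p'p : p' <= p.
  rewrite leNgt; apply/negP => p'p.
  have := mono _ _ (ltW p0) (ltW p'p) p'm'; have := dec _ _ (ltW p0) p'p.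
  have [/(_ _ p'm) T0 _ _ _] := LT.
  by rewrite Dp' Dpi; lra.
rewrite Rintegral_ramp ?x0 ?(ltW xp')// (rampE _ (ltW xp')).
set q := K * (p' - x).
have q0 : 0 < q by rewrite mulr_gt0// subr_gt0.
have qe : q <= K * e by rewrite ler_pM2l//; rewrite /x; lra.
have qd : q < d by apply: le_lt_trans ed.
have mq : derive_nonneg (C i) q < c + m.
  have := hd q; rewrite /= sub0r normrN gtr0_norm// nonneg_realsE.
  move=> /(_ qd (ltW q0)).
  rewrite ltr_norml => /andP[h _].
  (* [h] is stated for a copy of the function on the subspace topology. *)
  have {}h : - m < c - derive_nonneg (C i) q := h.
  lra.
have tC := cost_tangent (hC i) (ltW q0) (lexx 0).
have IS : 0 <= (\int[lebesgue_measure]_(t in `[0%R, p]) S i t)%R.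
  have := Lip_integral_ge K_gt0 (LS i) pm; rewrite -Sp0 expr0n/= mul0r//.
rewrite -Sp0 mulr0 sub0r; apply/negP; rewrite -ltNge.
have -> : K * (p' - x) ^+ 2 / 2 = q * (p' - x) / 2 by rewrite /q; ring.
have : 0 < q * (p' - (p' - x) / 2 - derive_nonneg (C i) q).
  by rewrite mulr_gt0//; rewrite /m /x in m0 em mq xp' *; lra.
lra.
Qed.

End game.

Theorem corollary1 (R : realType) (n : nat) (C : 'I_n -> R -> R) (D : R -> R)
    (K : R) (n_gt0 : (0 < n)%N) (hC : forall i, cost_function (C i))
    (hD : demand_function D) (K_gt0 : 0 < K) :
  (exists S : 'I_n -> R -> R, nash_equilibrium D C K S /\
     exists x : 'I_n -> R, forall i,
       0 <= x i <= max_price D /\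
       forall p, 0 <= p <= market_price D S -> S i p = K * pospart (p - x i))
  /\
  (forall S : 'I_n -> R -> R, nash_equilibrium D C K S ->
     forall i, 0 < S i (market_price D S) <->
               derive_within nonneg_reals (C i) 0 < market_price D S).
Proof.
split.
  have [S [nashS [x hx]]] := ramp_equilibrium_exists hC hD K_gt0.
  exists S; split=> //; exists x => i; have [xm ->] := hx i.
  by split.
move=> S nashS i; split; first exact: (active_marginal_lt hC hD K_gt0).
exact: (marginal_lt_active hC hD K_gt0).
Qed.
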